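(* For each positive integer $n$, there is an edge-ordered graph $G$ on $N = 2^{100n^2(\log_2 n)^2}$ vertices such that, for every two-coloring of the edges of $G$, there exists a monochromatic subgraph of $G$ containing a copy of every $n$-vertex edge-ordered graph $H$.
   Context: An edge-ordered graph is a finite simple graph together with a total ordering of its edges (equivalently, an assignment of distinct integer labels to its edges). Two edge-ordered graphs are equivalent if there is a graph isomorphism between them preserving the ordering of the edges. An edge-ordered graph $G$ contains a copy of an edge-ordered graph $H$ if some subgraph of $G$, with the edge-ordering inherited from $G$, is equivalent to $H$. *)

(* Defs.v *)
From mathcomp Require Import all_boot all_order all_algebra.
From mathcomp Require Import all_classical all_reals all_analysis.

Set Implicit Arguments.
Unset Strict Implicit.
Unset Printing Implicit Defensive.

Import Order.TTheory GRing.Theory Num.Theory.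

(* Vertices form a subset of an ambient finite type, so that subgraphs of a
   graph live over the same type.  [edge_le] is only meaningful on [edges];
   its values elsewhere are junk that no definition below looks at.
   Reflexivity on [edges] is the diagonal case of totality. *)
Record eograph (T : finType) := EOGraph {
  verts : {set T};
  edges : {set {set T}};
  edge_le : rel {set T};
  edgesP : forall e, e \in edges -> (e \subset verts) && (#|e| == 2);
  edge_le_anti : {in edges &, antisymmetric edge_le};
  edge_le_trans : {in edges & &, transitive edge_le};
  edge_le_total : {in edges &, total edge_le} }.

Definition subgraph (T : finType) (G' G : eograph T) : Prop :=
  [/\ verts G' \subset verts G,
      edges G' \subset edges G
    & {in edges G' &, edge_le G' =2 edge_le G}].

Definition equivalent (T U : finType) (G : eograph T) (H : eograph U) : Prop :=
  exists f : {x : T | x \in verts G} -> {y : U | y \in verts H},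
  [/\ bijective f,
      forall x y, ([set val (f x); val (f y)] \in edges H)
                  = ([set val x; val y] \in edges G)
    & forall x1 y1 x2 y2,
        [set val x1; val y1] \in edges G ->
        [set val x2; val y2] \in edges G ->
        edge_le H [set val (f x1); val (f y1)] [set val (f x2); val (f y2)]
        = edge_le G [set val x1; val y1] [set val x2; val y2]].

Definition contains_copy (T U : finType) (G : eograph T) (H : eograph U) : Prop :=
  exists G' : eograph T, subgraph G' G /\ equivalent G' H.

(* A two-coloring of the edges is a total map on vertex sets, of which only
   the restriction to edges matters. *)
Definition monochromatic (T : finType) (c : {set T} -> bool) (G : eograph T)
  : Prop := exists b : bool, {in edges G, forall e, c e = b}.

Definition log2 (R : realType) (x : R) : R := (ln x / ln 2)%R.

(* 2 ^ (100 n^2 (log2 n)^2) is not an integer in general; it is rounded down.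
   Rounding down is the stronger choice, since isolated vertices may be added
   to a host graph. *)
Definition host_order (R : realType) (n : nat) : nat :=
  Num.truncn (2 `^ (100 * n%:R ^+ 2 * log2 n%:R ^+ 2) : R)%R.

(* Main.v *)
Require Import Defs.
From mathcomp Require Import all_classical all_reals all_analysis.
From mathcomp Require Import all_boot all_order all_algebra all_field.
From mathcomp Require Import zify ring.

Set Implicit Arguments.
Unset Strict Implicit.
Unset Printing Implicit Defensive.

Import Order.TTheory GRing.Theory Num.Theory.

(* Let w = 2 ^ h be the least power of two >= n, m = w ^ 2 and L = m ^ w.  The
   host graph carries L label classes, viewed as the leaves of an m-ary tree of
   depth w, so that the subtrees are nested intervals of labels.  It is enough
   to find, for any two targets H1 and H2, a red copy of H1 or a blue copy of H2.

   Embed H1 greedily in red, sending its e-th edge to the e-th child of the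
   current interval.  If this gets stuck, there are large sets A and B between
   which one whole child interval is almost entirely blue.  Recursing inside B
   and then inside A, always with the latest interval, a binary tree of depth h
   yields w sets; as all w - 1 intervals met on the way are nested, the last one
   is almost entirely blue between any two of these sets, and its m labels serve
   the m edges of H2.  A second greedy embedding, now in blue, finds H2; it uses
   that the label classes of the host are pairwise independent, so that all but
   few vertices see the right proportion of each label in a given large set.

   The host is F ^ d x F with #|F| = L, the pair (x, s), (y, t) having the label
   x . y + s + t. *)

(** Pigeonhole, cleared of division: otherwise the sets are jointly too small to cover [V]. *)
Lemma exists_large_cover (X I : finType) (V : {set X}) (A : I -> {set X}) :
  0 < #|V| -> {in V, forall x, exists k, x \in A k} ->
  exists k, #|V| <= #|I| * #|A k|.
Proof.
move=> V0 cov.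
case: (pickP (fun k => #|V| <= #|I| * #|A k|)) => [k Vk|small]; first by exists k.
have le: #|V| <= \sum_k #|A k|.
  rewrite -sum1_card.
  apply: (@leq_trans (\sum_(x in V) \sum_k (x \in A k))).
    by apply: leq_sum => x /cov[k xA]; rewrite (bigD1 k) //= xA leq_addr.
  rewrite exchange_big; apply: leq_sum => k _.
  by rewrite -big_mkcondr /= sum1dep_card subset_leq_card //; apply/subsetP=> x; rewrite inE => /andP[].
have lt: #|I| * \sum_k #|A k| <= #|I| * #|V|.-1.
  rewrite big_distrr /= -sum_nat_const.
  by apply: leq_sum => k _; move: (small k) => /=; lia.
have I0 : 0 < #|I| by case/card_gt0P: V0 => x /cov[k _]; apply/card_gt0P; exists k.
by move: lt; rewrite leq_mul2l; lia.
Qed.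

(** * Greedy red embedding and sparse families *)

Section Core.
Variables (X : finType) (lab : X -> X -> nat) (red : rel X) (m : nat).
Hypothesis m_gt0 : 0 < m.

(* The subtree of height r and index c consists of the labels l with
   l %/ m ^ r = c; its e-th child has height r - 1 and index c * m + e. *)
Definition redin r c x y := [&& x != y, red x y & lab x y %/ m ^ r == c].

Lemma redin_sub r d c x y : redin r c x y -> redin (r + d) (c %/ m ^ d) x y.
Proof. by case/and3P=> xy rxy /eqP<-; rewrite /redin xy rxy expnD divnMA eqxx. Qed.

Section Greedy.
Variables (r c q w : nat) (u : nat).
Hypotheses (q_gt0 : 0 < q) (u_gt0 : 0 < u).

(** The vertex for index 0 is chosen in [V 0] so that every later candidate set shrinks by at most a
    factor [q]; [Q] records the shrinkage so far. If no vertex qualifies, pigeonhole gives a [k]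
    such that a 1/w share of [V 0] has low degree into [V k.+1]. *)
Lemma greedy_red (t : nat) (g : nat -> nat -> nat) (V : nat -> {set X}) Q (x0 : X) :
  t <= w ->
  (forall i j, i < j < t -> g i j < m) ->
  (forall k, k < t -> u <= Q * #|V k|) ->
  (exists phi : nat -> X, (forall i, i < t -> phi i \in V i) /\
     forall i j, i < j < t -> redin r (c * m + g i j) (phi i) (phi j)) \/
  (exists e i j (A B : {set X}), [/\ e < m, [&& i < t, j < t, A \subset V i & B \subset V j],
     u <= Q * q ^ t * (w * #|A|), u <= Q * q ^ t * #|B| &
     {in A, forall x, q * #|[set y in B | redin r (c * m + e) x y]| < #|B|}]).
Proof.
elim: t g V Q => [|t IH] g V Q tw gm uV; first by left; exists (fun=> x0); split=> // i j; rewrite ltn0 andbF.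
pose N v k := [set y in V k.+1 | redin r (c * m + g 0 k.+1) v y].
have [/existsP[v /andP[v0 /forallP/= vN]]|/existsPn/= bad] :=
    boolP [exists v, (v \in V 0) && [forall k : 'I_t, #|V k.+1| <= q * #|N v k|]].
  have [||k kt|[phi [phiV phir]]|[e [i [j [A [B [em /and4P[it jt AV BV] uA uB dAB]]]]]]] :=
    IH (fun i j => g i.+1 j.+1) (N v) (Q * q).
  - lia.
  - by move=> i j ij; apply: gm.
  - apply: (leq_trans (uV k.+1 kt)); rewrite -mulnA leq_mul2l; apply/orP; right.
    exact: (vN (Ordinal kt)).
  - left; exists (fun i => if i is i'.+1 then phi i' else v); split.
      by case=> [|i] // it; have := phiV i it; rewrite inE => /andP[].
    case=> [|i] [|j] // ij.
      by have := phiV j (proj2 (andP ij)); rewrite inE => /andP[].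
    exact: phir.
  - right; exists e, i.+1, j.+1, A, B; split=> //.
    + by apply/and4P; split=> //; [apply: (subset_trans AV) | apply: (subset_trans BV)];
        apply/subsetP=> y; rewrite inE => /andP[].
    + by rewrite expnS (mulnA Q).
    + by rewrite expnS (mulnA Q).
have V0 : 0 < #|V 0|.
  have := uV 0 isT; lia.
have [|k leA] := exists_large_cover (I := 'I_t)
  (A := fun k => [set v in V 0 | q * #|N v k| < #|V k.+1|]) V0.
  move=> v v0; have := bad v; rewrite v0 /= => /forallPn/=[k]; rewrite -ltnNge => vk.
  by exists k; rewrite inE v0.
have kt := ltn_ord k; rewrite card_ord in leA.
right; exists (g 0 k.+1), 0, k.+1, [set v in V 0 | q * #|N v k| < #|V k.+1|], (V k.+1); split.
- exact: gm.
- by apply/and4P; split=> //; apply/subsetP=> y; rewrite inE => /andP[].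
- apply: (leq_trans (uV 0 isT)); apply: leq_mul; first by rewrite leq_pmulr // expn_gt0 q_gt0.
  apply: (leq_trans leA); rewrite leq_mul2r; apply/orP; right; lia.
- apply: (leq_trans (uV k.+1 kt)); apply: leq_mul => //; by rewrite leq_pmulr // expn_gt0 q_gt0.
- by move=> v; rewrite inE => /andP[].
Qed.

End Greedy.

(* Averaging over a maximal disjoint family of P-sets in B: it covers half of B,
   so one of its members has at most twice the mean weight. *)
Lemma exhaustion (P : {set X} -> Prop) (wt : X -> nat) (a q s : nat) (B : {set X}) :
  (forall B' : {set X}, B' \subset B -> s <= #|B'| ->
     exists2 W : {set X}, W \subset B' & P W /\ 0 < #|W|) ->
  2 * s <= #|B| -> q * (\sum_(y in B) wt y) < a * #|B| ->
  exists2 W : {set X}, W \subset B & P W /\ q * (\sum_(y in W) wt y) <= 2 * a * #|W|.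
Proof.
move=> exW sB wtB; apply: contrapT => noW.
have a0 : 0 < a * #|B| by lia.
suff: 2 * a * (#|B| - s) <= q * \sum_(y in B) wt y.
  have: a * #|B| <= 2 * a * (#|B| - s).
    by rewrite -mulnA mulnCA leq_mul2l; apply/orP; right; lia.
  lia.
have [k] := ubnP #|B|; have: B \subset B by [].
(* [C] is what is left of [B] after removing disjoint members; [B] stays as the ambient set. *)
move: {1 3 4 5}B; elim: k => // k IH C CB Ck.
have [sC|Cs] := leqP s #|C|; last first.
  have -> : #|C| - s = 0 by lia.
  by rewrite muln0.
have [W WC [PW W0]] := exW C CB sC.
have WB := subset_trans WC CB.
have ltW : 2 * a * #|W| <= q * \sum_(y in W) wt y.
  by rewrite leqNgt; apply/negP => le; apply: noW; exists W => //; split=> //; exact: ltnW.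
have cCD : #|C :\: W| = #|C| - #|W| by rewrite cardsD (setIidPr WC).
have := IH (C :\: W); rewrite cCD => /(_ (subset_trans (subsetDl _ _) CB)) => h.
rewrite (big_setID W) /= (setIidPr WC) mulnDr.
have leC := subset_leq_card WC.
apply: (leq_trans _ (leq_add ltW (h _))); last by lia.
rewrite -mulnDr leq_mul2l; apply/orP; right; lia.
Qed.

Section Structure.
Variables (w q K0 : nat).
Hypotheses (q_gt0 : 0 < q) (w_gt0 : 0 < w) (K0_gt0 : 0 < K0).
Variable g : nat -> nat -> nat.
Hypothesis gm : forall i j, i < j < w -> g i j < m.
Hypothesis no_red : forall r c (phi : nat -> X),
  ~ (forall i j, i < j < w -> redin r (c * m + g i j) (phi i) (phi j)).

(** Each level loses a factor [w * q ^ w] to [sparse_pair] and a factor 2 to averaging. *)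
Definition threshold h := K0 * (2 * (w * q ^ w)) ^ h.

(** The factor [2 ^ h] appears because degrees are controlled into unions of parts. *)
Definition sparse_parts h r c (V : nat -> {set X}) :=
  (forall k, k < 2 ^ h -> #|V k| = K0) /\ forall i j, i < j < 2 ^ h ->
    {in V i, forall x, q * #|[set y in V j | redin r c x y]| <= 4 * 2 ^ h * K0}.

(** With all candidate sets equal to [U], success of [greedy_red] would contradict [no_red], so it
    gets stuck. *)
Lemma sparse_pair r c (U : {set X}) : 0 < #|U| ->
  exists c' (A B : {set X}), [/\ c' %/ m = c, A \subset U & B \subset U] /\
    [/\ #|U| <= w * q ^ w * #|A|, #|U| <= w * q ^ w * #|B| &
    {in A, forall x, q * #|[set y in B | redin r c' x y]| < #|B|}].
Proof.
move=> U0; have [x0 _] := card_gt0P U0.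
have [|[phi [_ phir]]|] := @greedy_red r c q w #|U| q_gt0 U0 w g (fun=> U) 1 x0 (leqnn _) gm.
- by move=> k _; rewrite mul1n.
- by case: (no_red phir).
move=> [e [i [j [A [B [em /and4P[_ _ AU BU] uA uB dAB]]]]]].
exists (c * m + e), A, B; split; split=> //.
- by rewrite divnMDl // divn_small // addn0.
- by rewrite (leq_trans uA) // mul1n mulnA (mulnC w).
- by rewrite (leq_trans uB) // mul1n leq_mul2r leq_pmull ?orbT.
Qed.

(* The interval is refined 2 ^ h - 1 times: B is treated first, so that one of
   its families can be chosen with small red degree from most of A, and the
   interval found there is refined further inside A. *)
Lemma sparse_partsP h r c (U : {set X}) : threshold h <= #|U| ->
  exists c' (V : nat -> {set X}), [/\ c' %/ m ^ (2 ^ h).-1 = c, forall k, k < 2 ^ h -> V k \subset U &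
     sparse_parts h r c' V].
Proof.
elim: h r c U => [|h IH] r c U.
  rewrite /threshold muln1 => /card_geqP[s [us ss sU]].
  exists c, (fun=> [set x in s]); split=> //; first by rewrite divn1.
    by move=> k _; apply/subsetP=> x; rewrite inE; apply: sU.
  split; last by move=> i j ij; exfalso; move: ij; rewrite expn0; lia.
  by move=> k _; rewrite cardsE (card_uniqP us).
move=> leU.
have wq0 : 0 < w * q ^ w by rewrite muln_gt0 w_gt0 expn_gt0 q_gt0.
have th0 k : 0 < threshold k by rewrite /threshold muln_gt0 K0_gt0 expn_gt0 muln_gt0 wq0.
have U0 : 0 < #|U| := leq_trans (th0 _) leU.
have thS A : #|U| <= w * q ^ w * A -> 2 * threshold h <= A.
  move=> leA; rewrite -(leq_pmul2l wq0) (leq_trans _ leA) // (leq_trans _ leU) //.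
  by rewrite /threshold expnS; nia.
have h0 : 0 < 2 ^ h by rewrite expn_gt0.
(* The height leaves room for two recursive calls, which descend [(2 ^ h).-1] levels each and end at
   height [r]. *)
have [c1 [A [B [[c1m AU BU] [/thS leA /thS leB dAB]]]]] :=
  sparse_pair (r + (2 ^ h).-1 + (2 ^ h).-1) c U0.
pose P (W : {set X}) := exists c2 (V : nat -> {set X}), [/\ c2 %/ m ^ (2 ^ h).-1 = c1,
  W = \bigcup_(k < 2 ^ h) V k & sparse_parts h (r + (2 ^ h).-1) c2 V].
pose R x y := redin (r + (2 ^ h).-1 + (2 ^ h).-1) c1 x y.
have [||W WB [[c2 [V2 [c2m WE [V2c V2r]]]] leW]] :=
    @exhaustion P (fun y => \sum_(x in A) R x y) #|A| q (threshold h) B _ leB.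
- move=> B' B'B /(IH (r + (2 ^ h).-1) c1)[c2 [V2 [c2m V2B V2s]]].
  exists (\bigcup_(k < 2 ^ h) V2 k); first by apply/bigcupsP => k _; exact: V2B.
  split; first by exists c2, V2.
  have := V2s.1 0 h0 => V20.
  apply: (@leq_trans #|V2 0|); first by rewrite V20.
  by rewrite subset_leq_card // (bigcup_sup (Ordinal h0)).
- have A0 : 0 < #|A| by have := th0 h; lia.
  have degE x : \sum_(y in B) R x y = #|[set y in B | R x y]|.
    by rewrite -sum1dep_card big_mkcondr.
  rewrite exchange_big big_distrr /= -sum_nat_const.
  have [x xA] := card_gt0P A0.
  rewrite (bigD1 x) //= [ltnRHS](bigD1 x) //=.
  rewrite -addSn leq_add //; first by rewrite degE; exact: dAB.
  by apply: leq_sum => y /andP[yA _]; rewrite degE; exact/ltnW/dAB.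
have WV k : k < 2 ^ h -> V2 k \subset W.
  by move=> kh; rewrite WE (bigcup_sup (Ordinal kh)).
have cW : #|W| <= 2 ^ h * K0.
  rewrite WE (@leq_trans (\sum_(k < 2 ^ h) #|V2 k|)) //; last first.
    by rewrite (eq_bigr (fun=> K0)) => [|k _]; rewrite ?sum_nat_const ?card_ord // V2c.
  elim/big_rec2: _ => [|k C D _ leCD]; first by rewrite cards0.
  by rewrite (leq_trans (leq_card_setU _ _)) // leq_add2l.
(* Markov: over [A], [q] times the red degree into [W] averages at most [2 * #|W|], so at least half
   of [A] survives. *)
pose A' := [set x in A | q * #|[set y in W | R x y]| <= 4 * #|W|].
have leA' : threshold h <= #|A'|.
  suff: #|A| <= 2 * #|A'| by lia.
  have degW : \sum_(x in A) #|[set y in W | R x y]| = \sum_(y in W) \sum_(x in A) R x y.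
    rewrite exchange_big; apply: eq_bigr => x _.
    by rewrite -sum1dep_card big_mkcondr.
  have : q * \sum_(x in A :\: A') #|[set y in W | R x y]| <= 2 * #|A| * #|W|.
    apply: (leq_trans _ leW); rewrite -degW leq_mul2l; apply/orP; right.
    by rewrite [leqRHS](big_setID A') /= leq_addl.
  have : 4 * #|W| * #|A :\: A'| <= q * \sum_(x in A :\: A') #|[set y in W | R x y]|.
    rewrite big_distrr /= mulnC -sum_nat_const; apply: leq_sum => x.
    by rewrite !inE => /andP[/nandP[/negP|]]; [|rewrite -ltnNge => /ltnW].
  have W0 : 0 < #|W|.
    by rewrite (leq_trans K0_gt0) // -(V2c 0) // subset_leq_card // WV.
  have cA : #|A| = #|A'| + #|A :\: A'|.
    by rewrite cardsD (setIidPr _) ?subnKC ?subset_leq_card //; apply/subsetP=> x; rewrite inE => /andP[].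
  move=> h1 h2; have := leq_trans h1 h2.
  rewrite (_ : 4 * #|W| * #|A :\: A'| = #|W| * (4 * #|A :\: A'|)); last by lia.
  rewrite (_ : 2 * #|A| * #|W| = #|W| * (2 * #|A|)); last by lia.
  rewrite leq_pmul2l //; lia.
have [c3 [V3 [c3m V3A [V3c V3r]]]] := IH r c2 A' leA'.
(* The parts inside [A] come first, since the degree bound between the halves goes from [A'] into
   [W]. *)
exists c3, (fun k => if k < 2 ^ h then V3 k else V2 (k - 2 ^ h)).
have AA : A' \subset A by apply/subsetP => x; rewrite inE => /andP[].
split.
  rewrite -c1m -c2m -c3m -!divnMA ?mulnA -expnD -expnSr; congr (_ %/ _ ^ _).
  rewrite expnS; lia.
- move=> k; rewrite expnS /= => kh2; case: ltnP => kh.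
    exact: (subset_trans (V3A k kh) (subset_trans AA AU)).
  by apply: (subset_trans (WV _ _) (subset_trans WB BU)); lia.
split.
  by move=> k; rewrite expnS /= => kh2; case: ltnP => kh; [exact: V3c | apply: V2c; lia].
move=> i j; rewrite expnS /= => /andP[ij jh] x.
have sub23 y z : redin r c3 y z -> redin (r + (2 ^ h).-1) c2 y z.
  by rewrite -c3m; exact: redin_sub.
have sub13 y z : redin r c3 y z -> R y z.
  by move=> /sub23/(@redin_sub _ (2 ^ h).-1); rewrite c2m.
have mono (p1 p2 : rel X) (C D : {set X}) z : C \subset D -> (forall y, p1 z y -> p2 z y) ->
   #|[set y in C | p1 z y]| <= #|[set y in D | p2 z y]|.
  move=> CD p12; apply/subset_leq_card/subsetP => y; rewrite !inE => /andP[yC pzy].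
  by rewrite (subsetP CD) ?p12.
case: (ltnP i) => ih; case: (ltnP j) => jh2.
- move=> xi; apply: (leq_trans (V3r i j _ x xi)); first by rewrite ij.
  nia.
- move=> /(subsetP (V3A _ ih)); rewrite inE => /andP[xA dx].
  apply: (@leq_trans (q * #|[set y in W | R x y]|)).
    rewrite leq_mul2l (mono _ R _ W) ?orbT //; first by apply: WV; lia.
    exact: sub13.
  apply: (leq_trans dx); nia.
- lia.
move=> xi; apply: (@leq_trans (q * #|[set y in V2 (j - 2 ^ h) | redin (r + (2 ^ h).-1) c2 x y]|)).
  by rewrite leq_mul2l (mono _ (redin (r + (2 ^ h).-1) c2)) ?orbT //; exact: sub23.
apply: (leq_trans (V2r _ _ _ x xi)); [lia | nia].
Qed.

End Structure.
End Core.

(** * Greedy blue embedding *)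

Section Blue.
Variables (X : finType) (lab : X -> X -> nat) (bad : rel X) (lam h a0 b0 : nat).
Let L := 2 ^ lam.
Let N := #|X|.
Let w := 2 ^ h.
Hypothesis lam_gt0 : 0 < lam.
Hypothesis few_low : forall (S : {set X}) l, l < L ->
  #|[set v | 2 * L * #|[set y in S | lab v y == l]| < #|S|]| * #|S| <= 4 * L * N.
Hypothesis few_high : forall (S : {set X}) s l, l < L -> #|S| <= s ->
  #|[set v | 2 * s < L * #|[set y in S | lab v y == l]|]| * s <= L * N.
Hypothesis a0_b0 : b0 + lam + 4 <= a0.
Hypothesis N_small : 32 * w ^ 3 * L ^ 2 * N < 2 ^ (a0 + b0).

(** A typical choice of the first vertex divides set sizes by at most 4L = 2^(lam+2) and bad degrees
    by at least L/2 = 2^(lam-1). These rates give the exponents, [t] being the number of vertices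
    still to be placed. *)
Lemma blue_embedding t (g : nat -> nat -> nat) (V : nat -> {set X}) (x0 : X) :
  t <= w -> (forall i j, i < j < t -> g i j < L) ->
  (forall k, k < t -> 2 ^ (a0 + t * (lam + 2)) <= #|V k|) ->
  (forall i j, i < j < t -> {in V i, forall x,
     #|[set y in V j | bad x y]| <= 2 ^ (b0 + t * lam.-1)}) ->
  exists phi : nat -> X, (forall i, i < t -> phi i \in V i) /\
    forall i j, i < j < t -> [/\ phi i != phi j, lab (phi i) (phi j) = g i j & ~~ bad (phi i) (phi j)].
Proof.
elim: t g V => [|t IH] g V tw gL Va Vr.
  by exists (fun=> x0); split=> // i j; rewrite ltn0 andbF.
set a := 2 ^ (a0 + t.+1 * (lam + 2)) in Va; set rho := 2 ^ (b0 + t.+1 * lam.-1) in Vr.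
have L0 : 0 < L by rewrite expn_gt0.
have w0 : 0 < w by rewrite expn_gt0.
have rho0 : 0 < rho by rewrite expn_gt0.
have rho_a : 16 * L * rho <= a.
  by rewrite (_ : 16 = 2 ^ 4) // -!expnD leq_exp2l //; nia.
have rho_a_large : 32 * w ^ 3 * L ^ 2 * N < a * rho.
  apply: (leq_trans N_small); rewrite -expnD leq_exp2l //; nia.
(* C v j k collects the vertices of V j.+1 with too many bad neighbours left in
   V k.+1 once v is chosen; they are deleted from V j.+1.  The set E e gathers the
   choices of v that leave too small a set or force too many deletions. *)
pose B v k y := [set z in V k.+1 | bad y z & lab v z == g 0 k.+1].
pose C v j k := [set y in V j.+1 | 2 * rho < L * #|B v k y|].
pose E (e : option 'I_t * 'I_t) := if e.1 is Some j then
    if j < e.2 then [set v | #|V j.+1| < 16 * L * w * #|C v j e.2|] else set0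
  else [set v | 2 * L * #|[set y in V e.2.+1 | lab v y == g 0 e.2.+1]| < #|V e.2.+1|].
have smallE e : #|E e| * rho <= 16 * L ^ 2 * w * N.
  case: e => [[j|] k]; rewrite /E /=; last first.
    have kt : k.+1 < t.+1 by exact: ltn_ord.
    apply: (@leq_trans (4 * L * N)).
      apply: (leq_trans _ (few_low _ (gL 0 k.+1 kt))).
      by apply: leq_mul => //; apply: (leq_trans _ (Va _ kt)); nia.
    rewrite (_ : 16 * L ^ 2 * w * N = 4 * L * N * (4 * L * w)); last by lia.
    by rewrite leq_pmulr // !muln_gt0 L0 w0.
  case: ifP => [jk|_]; last by rewrite cards0.
  have kt : k.+1 < t.+1 by exact: ltn_ord.
  have jt : j.+1 < t.+1 by exact: ltn_ord.
  have jk' : j.+1 < k.+1 < t.+1 by rewrite ltnS jk.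
  have V0 : 0 < #|V j.+1| by apply: leq_trans (Va _ jt); rewrite expn_gt0.
  rewrite -(leq_pmul2l V0).
  set D := [set v | _].
  (* Markov over [v]; the pairs (v, y) are then counted from [y], with [few_high] applied to the bad
     neighbours of [y] in [V k.+1]. *)
  have h1 : #|V j.+1| * #|D| <= 16 * L * w * \sum_v #|C v j k|.
    rewrite mulnC -sum_nat_const big_distrr /= [leqRHS](bigID (mem D)) /=.
    by apply: leq_trans (leq_addr _ _); apply: leq_sum => v; rewrite inE => /ltnW.
  have h2 : (\sum_v #|C v j k|) * rho <= #|V j.+1| * (L * N).
    have -> : \sum_v #|C v j k| = \sum_(y in V j.+1) #|[set v | 2 * rho < L * #|B v k y|]|.
      under eq_bigr do rewrite -sum1dep_card big_mkcondr /=.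
      by rewrite exchange_big; apply: eq_bigr => y _; rewrite -big_mkcond sum1dep_card.
    rewrite big_distrl -sum_nat_const; apply: leq_sum => y yV.
    have := @few_high [set z in V k.+1 | bad y z] rho (g 0 k.+1) (gL 0 k.+1 kt) (Vr j.+1 k.+1 jk' y yV).
    apply: leq_trans; rewrite leq_mul2r subset_leq_card ?orbT //.
    apply/subsetP => v; rewrite !inE; congr (_ < L * _); apply: eq_card => z.
    by rewrite !inE andbA.
  rewrite mulnA; apply: (leq_trans (leq_mul h1 (leqnn rho))).
  rewrite -mulnA; apply: (leq_trans (leq_mul (leqnn _) h2)); lia.
have V00 : 0 < #|V 0| by apply: leq_trans (Va 0 _) => //; rewrite expn_gt0.
(* The sets [E e], at most [w ^ 2] in number, are together too small to cover [V 0]. *)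
have [v vV vE] : exists2 v, v \in V 0 & forall e, v \notin E e.
  apply: contrapT => noV.
  have [|e leE] := exists_large_cover (A := E) V00.
    move=> v vV; apply: contrapT => vE; apply: noV; exists v => // e.
    by apply/negP => ve; apply: vE; exists e.
  move: leE; rewrite card_prod card_option card_ord => leE.
  have : a * rho <= w ^ 2 * (16 * L ^ 2 * w * N).
    apply: (leq_trans (leq_mul (leq_trans (Va 0 isT) leE) (leqnn rho))).
    by rewrite -mulnA leq_mul // ?smallE //; nia.
  lia.
pose V' k := [set y in V k.+1 | [&& y != v, lab v y == g 0 k.+1, ~~ bad v y &
    [forall k' : 'I_t, (k < k') ==> (L * #|B v k' y| <= 2 * rho)]]].
have [|||phi [phiV phiP]] := IH (fun i j => g i.+1 j.+1) V' (ltnW tw).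
- by move=> i j ij; apply: gL.
- move=> k kt.
  have kt1 : k.+1 < t.+1 by [].
  (* The label class of [v] has at least |V|/(2L) elements, where V is [V k.+1]; [v] itself, its bad
     neighbours and the sets [C] together each remove at most |V|/(16L). *)
  have : #|V k.+1| <= 4 * L * #|V' k|.
    have lowk := vE (None, Ordinal kt); rewrite inE /= -leqNgt in lowk.
    have Ck (k' : 'I_t) : k < k' -> 16 * L * w * #|C v k k'| <= #|V k.+1|.
      by move=> kk; have := vE (Some (Ordinal kt), k'); rewrite /E /= kk inE -leqNgt.
    have sumC : 16 * L * \sum_(k' < t | k < k') #|C v k k'| <= #|V k.+1|.
      apply: (@leq_trans (16 * L * \sum_(k' < t) (k < k') * #|C v k k'|)).
        rewrite leq_mul2l; apply/orP; right; rewrite big_mkcond; apply: leq_sum => k' _.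
        by case: ifP => _; rewrite ?mul1n.
      rewrite -(leq_pmul2l w0) mulnA big_distrr /=.
      apply: (@leq_trans (\sum_(k' < t) #|V k.+1|)).
        apply: leq_sum => k' _; case: ltnP => kk; last by rewrite mul0n muln0.
        by rewrite mul1n; apply: leq_trans (Ck _ kk); nia.
      by rewrite sum_nat_const card_ord leq_mul2r ltnW ?orbT.
    have badv : #|[set y in V k.+1 | bad v y]| <= rho by apply: Vr vV.
    have cov : #|[set y in V k.+1 | lab v y == g 0 k.+1]| <=
       #|V' k| + (1 + (#|[set y in V k.+1 | bad v y]| + \sum_(k' < t | k < k') #|C v k k'|)).
      have sub : [set y in V k.+1 | lab v y == g 0 k.+1] \subset
          V' k :|: ([set v] :|: ([set y in V k.+1 | bad v y] :|: \bigcup_(k' < t | k < k') C v k k')).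
        apply/subsetP => y; rewrite inE => /andP[yV yl].
        rewrite !(in_setU, in_set1).
        have [//|yv] := eqVneq y v; first by rewrite orbT.
        have [ybad|ngood] := boolP (bad v y); first by rewrite !inE yV ybad !orbT.
        have [Cy|/bigcupP noC] := boolP (y \in \bigcup_(k' < t | k < k') C v k k').
          by rewrite !orbT.
        apply/orP; left; rewrite inE yV yv yl ngood /=; apply/forallP => k'.
        apply/implyP => kk; rewrite leqNgt; apply/negP => lt; apply: noC.
        by exists k' => //; rewrite inE yV.
      apply: (leq_trans (subset_leq_card sub)).
      rewrite (leq_trans (leq_card_setU _ _)) // leq_add2l.
      rewrite (leq_trans (leq_card_setU _ _)) // cards1 leq_add2l.
      rewrite (leq_trans (leq_card_setU _ _)) // leq_add2l.
      elim/big_rec2: _ => [|k' D d _ leCD]; first by rewrite cards0.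
      by rewrite (leq_trans (leq_card_setU _ _)) // leq_add2l.
    have := Va _ kt1; rewrite -/a => leV.
    have := leq_mul (leqnn (16 * L)) cov.
    have := leq_mul (leqnn (16 * L)) badv.
    set s1 := \sum_(k' < t | _) _ in sumC *; nia.
  move=> /(leq_trans (Va _ kt1)).
  move=> leV'; rewrite -(@leq_pmul2l (4 * L)) ?muln_gt0 //; apply: leq_trans leV'.
  rewrite (_ : 4 = 2 ^ 2) // -!expnD leq_exp2l //; nia.
- move=> i j /andP[ij jt] x; rewrite inE => /and5P[xV _ _ _ /forallP/(_ (Ordinal jt))/=].
  rewrite ij /= => degx.
  rewrite -(leq_pmul2l L0); apply: (@leq_trans (2 * rho)); last first.
    by rewrite -[X in X * _](expn1 2) -!expnD leq_exp2l //; nia.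
  apply: leq_trans degx; rewrite leq_mul2l subset_leq_card ?orbT //.
  by apply/subsetP => y; rewrite !inE => /andP[/and5P[-> _ -> _ _] ->].
exists (fun i => if i is i'.+1 then phi i' else v); split.
  by case=> [|i] // it; have := phiV i it; rewrite inE => /andP[].
case=> [|i] [|j] // ij; last exact: phiP.
have := phiV j (proj2 (andP ij)); rewrite inE => /and5P[_ + /eqP + + _].
by rewrite eq_sym.
Qed.
End Blue.

(** * Combining the red and blue embeddings *)

Section Ramsey.
Variables (X : finType) (lab : X -> X -> nat) (red : rel X) (h : nat).
Let w := 2 ^ h.
Let m := 2 ^ (2 * h).
Let lam := 2 * h * w.
(* The thresholds below multiply up to at most 2 ^ nu, and nu is a multiple of
   the binary logarithm 2 * h * w of the number of labels. *)
Let nu := 4 * h ^ 2 * w ^ 2 + 28 * h * w ^ 2.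
Let L := 2 ^ lam.
Hypothesis h_gt0 : 0 < h.
Hypothesis cardX : #|X| = 2 ^ nu.
Hypothesis few_low : forall (S : {set X}) l, l < L ->
  #|[set v | 2 * L * #|[set y in S | lab v y == l]| < #|S|]| * #|S| <= 4 * L * #|X|.
Hypothesis few_high : forall (S : {set X}) s l, l < L -> #|S| <= s ->
  #|[set v | 2 * s < L * #|[set y in S | lab v y == l]|]| * s <= L * #|X|.

(** Each pair lands in a prescribed child of one common interval, so that labels compare as these
    prescriptions do. Without a red solution, the sparse parts serve as candidate sets for the blue
    embedding. *)
Lemma two_color_ramsey (g1 g2 : nat -> nat -> nat) :
  (forall i j, i < j < w -> g1 i j < m) -> (forall i j, i < j < w -> g2 i j < m) ->
  exists (b : bool) (phi : nat -> X) r c, forall i j, i < j < w ->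
    [/\ phi i != phi j, red (phi i) (phi j) = b &
        lab (phi i) (phi j) %/ m ^ r = c * m + (if b then g1 else g2) i j].
Proof.
move=> g1m g2m; apply: contrapT => none.
have no_red r c (phi : nat -> X) :
    ~ (forall i j, i < j < w -> redin lab red m r (c * m + g1 i j) (phi i) (phi j)).
  move=> phir; apply: none; exists true, phi, r, c => i j ij.
  by have /and3P[? ? /eqP ?] := phir i j ij.
(* [b0] is nu/2 + lam/2 + 2h, enough for 32 w^3 L^2 |X| < 2^(a0+b0). [K0] is the set size that
   [blue_embedding] starts from, and [kap] is exactly what turns the bound of [sparse_parts] into
   its initial bad degree. *)
pose b0 := 2 * h ^ 2 * w ^ 2 + 14 * h * w ^ 2 + h * w + 2 * h.
pose a0 := b0 + lam + 5.
pose kap := lam + 3 * w + h + 7.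
pose K0 := 2 ^ (a0 + w * (lam + 2)).
have w0 : 0 < w by rewrite expn_gt0.
have m0 : 0 < m by rewrite expn_gt0.
have w2h : 2 * h <= w.
  by rewrite /w; case: (h) h_gt0 => // k _; rewrite expnS leq_mul2l /= ltn_expl.
have lam0 : 0 < lam by rewrite !muln_gt0 h_gt0 w0.
have K00 : 0 < K0 by rewrite expn_gt0.
have q0 : 0 < 2 ^ kap by rewrite expn_gt0.
(* From the root, of height [w] and index 0, the w - 1 refinements lead to height 1, an interval of
   [m] consecutive labels. *)
have [|c [V [cm VT [Vc Vr]]]] :=
  @sparse_partsP X lab red m m0 w (2 ^ kap) K0 q0 w0 K00 g1 g1m no_red h 1 0 [set: X].
  rewrite cardsT cardX /threshold /K0 {2}/w -expnM -expnD -expnS -expnM -expnD leq_exp2l //.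
  (* The leading term of the exponent is that of [nu]; the lower ones are absorbed into multiples of
     h w^2. *)
  have x1 : 2 * h * w <= h * w * w by nia.
  have x2 : 2 * h * h * w <= h * w * w by nia.
  have x3 : 4 * h <= h * w * w by nia.
  have x4 : 2 * w <= h * w * w by nia.
  have x5 : 4 * h * h <= h * w * w by nia.
  rewrite /a0 /kap /b0 /nu /lam; lia.
have mw : m ^ w = L by rewrite /m /L -expnM.
have cL (e : nat) : e < m -> c * m + e < L.
  move=> em; have : c < m ^ w.-1.
    by rewrite ltnNge -divn_gt0 ?cm // expn_gt0 m0.
  rewrite -mw -{2}(prednK w0) expnSr; nia.
have [x0 _] : exists x0 : X, x0 \in [set: X].
  by apply/card_gt0P; rewrite cardsT cardX expn_gt0.
have [|||||phi [_ phiP]] := @blue_embedding X lab (redin lab red m 1 c) lam h a0 b0 lam0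
    few_low few_high _ _ w (fun i j => c * m + g2 i j) V x0 (leqnn w).
- rewrite /a0; lia.
- rewrite cardX -/w /w -expnM (_ : 32 = 2 ^ 5) // -expnM -!expnD ltn_exp2l //.
  rewrite /a0 /b0 /nu -/w /lam; lia.
- by move=> i j ij; apply/cL/g2m.
- by move=> k kw; rewrite Vc.
- move=> i j ij x xV.
  rewrite -(leq_pmul2l q0); apply: leq_trans (Vr i j ij x xV) _.
  rewrite (_ : 4 = 2 ^ 2) // /K0 -!expnD leq_exp2l // /kap /a0; nia.
apply: none; exists false, phi, 0, c => i j ij.
have [ne labE] := phiP i j ij.
rewrite /redin ne labE expn1 divnMDl // divn_small ?g2m // addn0 eqxx andbT /= => /negbTE ->.
by rewrite divn1.
Qed.
End Ramsey.

(** * The host graph *)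

Section SecondMoment.
Variables (X : finType) (lab : X -> X -> nat) (L : nat).
Let N := #|X|.
Hypothesis first_moment : forall l y, l < L -> L * #|[set v | lab v y == l]| = N.
Hypothesis pair_moment : forall l y y', l < L -> y != y' ->
  L ^ 2 * #|[set v | (lab v y == l) && (lab v y' == l)]| <= N.

Let deg (S : {set X}) l v := #|[set y in S | lab v y == l]|.
(** An absolute difference: one of the two truncated subtractions vanishes. *)
Let dist (S : {set X}) l v := (L * deg S l v - #|S|) + (#|S| - L * deg S l v).

(** Variance of a sum of pairwise independent indicators: off-diagonal pairs contribute no
    covariance, and each diagonal term at most L N after scaling. *)
Lemma second_moment (S : {set X}) l : l < L ->
  \sum_v dist S l v ^ 2 <= L * N * #|S|.
Proof.
move=> lL.
have degE v : deg S l v = \sum_(y in S) (lab v y == l).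
  by rewrite /deg -sum1dep_card big_mkcondr.
have sum1 : L * \sum_v deg S l v = #|S| * N.
  under eq_bigr do rewrite degE.
  rewrite exchange_big big_distrr /= -sum_nat_const; apply: eq_bigr => y _.
  by rewrite -(first_moment y lL) -sum1dep_card [in RHS]big_mkcond.
have sum2 : L ^ 2 * \sum_v deg S l v ^ 2 <= L * N * #|S| + #|S| ^ 2 * N.
  have -> : \sum_v deg S l v ^ 2 =
      \sum_(y in S) \sum_(y' in S) #|[set v | (lab v y == l) && (lab v y' == l)]|.
    under eq_bigr do rewrite degE -mulnn big_distrl /=.
    rewrite exchange_big; apply: eq_bigr => y _ /=.
    under eq_bigr do rewrite big_distrr /=.
    rewrite exchange_big; apply: eq_bigr => y' _ /=.
    rewrite -sum1dep_card [in RHS]big_mkcond; apply: eq_bigr => v _.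
    by case: (lab v y == l); case: (lab v y' == l).
  have -> : L * N * #|S| + #|S| ^ 2 * N = \sum_(y in S) (L * N + \sum_(y' in S) N).
    by rewrite big_split /= !sum_nat_const; lia.
  rewrite big_distrr /=; apply: leq_sum => y yS.
  rewrite big_distrr /= (bigD1 y) //= [in leqRHS](bigD1 y) //=.
  rewrite addnA leq_add //.
    under eq_finset do rewrite andbb.
    by rewrite -mulnn -mulnA first_moment // leq_addr.
  by apply: leq_sum => y' /andP[_ yy']; rewrite pair_moment // eq_sym.
have sqr v : (L * deg S l v) ^ 2 + #|S| ^ 2 = 2 * #|S| * (L * deg S l v) + dist S l v ^ 2.
  by rewrite /dist; nia.
have : \sum_v (L * deg S l v) ^ 2 + N * #|S| ^ 2 =
    2 * #|S| * (#|S| * N) + \sum_v dist S l v ^ 2.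
  rewrite -sum1 mulnA -[N * _]sum_nat_const -big_split /=.
  rewrite [in RHS]big_distrr -big_split /=.
  by apply: eq_bigr => v _; rewrite -mulnA; exact: sqr.
have -> : \sum_v (L * deg S l v) ^ 2 = L ^ 2 * \sum_v deg S l v ^ 2.
  by rewrite big_distrr; apply: eq_bigr => v _; rewrite expnMn.
lia.
Qed.

(** Chebyshev: a degree below half of the mean |S|/L is off by more than half of it. *)
Lemma few_low (S : {set X}) l : l < L ->
  #|[set v | 2 * L * #|[set y in S | lab v y == l]| < #|S|]| * #|S| <= 4 * L * N.
Proof.
move=> lL; have [->|S0] := posnP #|S|; first by rewrite muln0.
rewrite -(leq_pmul2r S0) -!mulnA mulnn (mulnA L).
apply: leq_trans (leq_mul (leqnn 4) (second_moment S lL)).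
rewrite -sum_nat_const [in leqRHS](bigID (mem [set v | 2 * L * deg S l v < #|S|])) /= mulnDr.
apply: leq_trans (leq_addr _ _); rewrite big_distrr; apply: leq_sum => v.
rewrite inE -mulnA => lt; have le : #|S| <= 2 * dist S l v by rewrite /dist /deg; lia.
by apply: leq_trans (leq_mul le le) _; rewrite mulnACA mulnn.
Qed.

(** Chebyshev with deviation [s], so that the bound scales with [s] even when [S] is smaller. *)
Lemma few_high (S : {set X}) s l : l < L -> #|S| <= s ->
  #|[set v | 2 * s < L * #|[set y in S | lab v y == l]|]| * s <= L * N.
Proof.
move=> lL Ss; have [->|s0] := posnP s; first by rewrite muln0.
rewrite -(leq_pmul2r s0) -mulnA mulnn.
apply: leq_trans (leq_mul (leqnn (L * N)) Ss).
apply: leq_trans (second_moment S lL).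
rewrite -sum_nat_const [leqRHS](bigID (mem [set v | 2 * s < L * deg S l v])) /=.
apply: leq_trans (leq_addr _ _); apply: leq_sum => v.
rewrite inE => lt; have le : s <= dist S l v by rewrite /dist /deg; lia.
by apply: leq_trans (leq_mul le le) _; rewrite mulnn.
Qed.
End SecondMoment.

(** * Pairwise independent labels from inner products over a finite field *)

Section InnerProductHost.
Local Open Scope ring_scope.
Variables (F : finFieldType) (d : nat).
Definition host_vertex := ('rV[F]_d * F)%type.
(** The summands [x.2] and [y.2] make colors towards a fixed [y] uniform even if [y.1] is 0, and
    separate vertices with equal first components. *)
Definition host_color (x y : host_vertex) : F :=
  (x.1 *m y.1^T) 0 0 + x.2 + y.2.
Definition host_label (x y : host_vertex) : nat := enum_rank (host_color x y).

Lemma host_labelC : commutative host_label.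
Proof.
move=> x y; rewrite /host_label /host_color -addrA (addrC x.2) addrA; congr (nat_of_ord (enum_rank (_ + _ + _))).
by rewrite -[y.1 in RHS]trmxK -trmx_mul [RHS]mxE.
Qed.

Lemma card_host_vertex : #|{: host_vertex}| = (#|F| ^ d.+1)%N.
Proof. by rewrite card_prod card_mx mul1n expnSr. Qed.

Lemma host_labelE l (lF : (l < #|F|)%N) x y :
  (host_label x y == l) = (host_color x y == enum_val (Ordinal lF)).
Proof. by rewrite -(inj_eq enum_rank_inj) enum_valK. Qed.

(** Translations along a coordinate where [z] is nonzero permute the level sets transitively. *)
Lemma card_hyperplane (z : 'rV[F]_d) (c : F) : z != 0 ->
  (#|F| * #|[set u : 'rV[F]_d | ((u *m z^T) 0 0 == c)%R]| = #|F| ^ d)%N.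
Proof.
move=> z0; have [i zi] : exists i, z 0 i != 0.
  by apply/existsP; apply: contraNT z0 => /existsPn z0; apply/eqP/rowP => i; rewrite mxE; apply/eqP; have := z0 i; rewrite negbK.
pose f a := fun u : 'rV[F]_d => u + (a / z 0 i) *: delta_mx 0 i.
have fE a u : (f a u *m z^T) 0 0 = (u *m z^T) 0 0 + a.
  by rewrite mulmxDl -scalemxAl -rowE !mxE divfK.
have same a : #|[set u : 'rV[F]_d | (u *m z^T) 0 0 == a]| = #|[set u : 'rV[F]_d | (u *m z^T) 0 0 == c]|.
  rewrite -[in RHS](card_imset _ (addIr (((a - c) / z 0 i) *: delta_mx 0 i))).
  apply: eq_card => u; rewrite inE; apply/idP/imsetP => [/eqP ua|[v]].
    exists (f (c - a) u); first by rewrite inE fE ua addrC subrK.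
    by rewrite /f -addrA -scalerDl -mulrDl addrA subrK subrr mul0r scale0r addr0.
  by rewrite inE => /eqP vc ->; rewrite fE vc addrC subrK.
have -> : (#|F| ^ d = #|{: 'rV[F]_d}|)%N by rewrite card_mx mul1n.
rewrite -sum_nat_const -[RHS]sum1_card (partition_big (fun u : 'rV[F]_d => (u *m z^T) 0 0) predT) //=.
by apply: eq_bigr => a _; rewrite -(same a) -sum1dep_card.
Qed.

(** For each first component exactly one second component gives the label. *)
Lemma host_first_moment l y : (l < #|F|)%N ->
  (#|F| * #|[set v | host_label v y == l]| = #|{: host_vertex}|)%N.
Proof.
move=> lF; rewrite card_host_vertex expnS; congr (_ * _)%N.
move: (enum_val (Ordinal lF)) (host_labelE lF) => c lE.
rewrite -[RHS](_ : #|{: 'rV[F]_d}| = _); last by rewrite card_mx mul1n.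
rewrite -[RHS]cardsT -(card_imset _ (f := fun u : 'rV[F]_d => (u, c - y.2 - (u *m y.1^T) 0 0))); last first.
  by move=> u v [].
apply: eq_card => -[u t]; rewrite inE lE /host_color /=.
apply/eqP/imsetP => [<-|[v _ [-> ->]]]; last by rewrite [_ + (_ - _)]addrC subrK subrK.
by exists u => //; rewrite addrK [_ + t]addrC addrK.
Qed.

(** Subtracting the two equations puts [v.1] on a hyperplane, or gives a contradiction if [y.1]
    equals [y'.1]; [v.1] then determines [v.2]. *)
Lemma host_pair_moment l y y' : (l < #|F|)%N -> y != y' ->
  (#|F| ^ 2 * #|[set v | (host_label v y == l) && (host_label v y' == l)]| <= #|{: host_vertex}|)%N.
Proof.
move=> lF yy'; rewrite card_host_vertex.
set c := enum_val (Ordinal lF).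
set D := [set v | _].
have DE (v : host_vertex) : v \in D -> (v.1 *m (y.1 - y'.1)^T) 0 0 == y'.2 - y.2.
  rewrite inE !(host_labelE lF) /host_color => /andP[/eqP e1 /eqP]; rewrite -e1 => e2.
  have mxB (A B : 'M[F]_1) : (A - B) 0 0 = A 0 0 - B 0 0 by rewrite !mxE.
  rewrite linearB /= mulmxBr mxB subr_eq.
  by rewrite -(inj_eq (addIr v.2)) -(inj_eq (addIr y.2)) -e2; apply/eqP; ring.
have injD : {in D &, injective fst}.
  move=> [u t] [u' t']; rewrite !inE !(host_labelE lF) /host_color /= => /andP[/eqP e1 _] /andP[/eqP e2 _] uu'.
  by move: e1; rewrite -e2 uu' => /addIr/addrI ->.
have [y1|y1] := eqVneq y.1 y'.1.
  suff -> : D = set0 by rewrite cards0 muln0.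
  apply/setP => v; rewrite [RHS]inE; apply/negP => /DE.
  rewrite y1 subrr trmx0 mulmx0 mxE eq_sym subr_eq0 => /eqP y2.
  by case/eqP: yy'; rewrite (surjective_pairing y) (surjective_pairing y') y1 y2.
rewrite -mulnn -mulnA (expnS _ d) leq_mul2l; apply/orP; right.
rewrite -(@card_hyperplane (y.1 - y'.1) (y'.2 - y.2)) ?subr_eq0 // leq_mul2l; apply/orP; right.
rewrite -(card_in_imset injD) subset_leq_card //; apply/subsetP => u /imsetP[v vD ->].
by rewrite inE DE.
Qed.
End InnerProductHost.

(** * Comparing the number of vertices with the prescribed order *)

Lemma log2_lower_bound (R : realType) (n p q : nat) :
  0 < n -> 2 ^ p <= n ^ q -> (p%:R <= q%:R * log2 (n%:R : R))%R.
Proof.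
move=> n0 pn.
have ln2 : (0 < ln (2 : R))%R by rewrite ln_gt0 // ltr1n.
rewrite /log2 mulrA ler_pdivlMr // ![(_%:R * ln _)%R]mulr_natl -!lnXn ?ltr0n //.
by rewrite ler_ln ?posrE ?exprn_gt0 ?ltr0n // -!natrX ler_nat.
Qed.

Lemma host_order_lower_bound (R : realType) (n h : nat) (w := 2 ^ h) :
  0 < h -> 2 ^ h.-1 < n ->
  2 ^ (4 * h ^ 2 * w ^ 2 + 28 * h * w ^ 2) <= host_order R n.
Proof.
move=> h0 hn; set nu := 4 * _ * _ + _.
(* p / q is a rational lower bound of log2 n; at small h the estimate
   log2 n >= h - 1 would be too weak. *)
have [p [q [q0 pq nuq]]] : exists p q, [/\ 0 < q, 2 ^ p <= n ^ q & q ^ 2 * nu <= 100 * n ^ 2 * p ^ 2].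
  (* For h = 1, 2, 3 the bounds n >= 2, 3, 5 are used directly; from h = 4 on, w^2 <= 4 n^2 and log2
     n >= h - 1 suffice. *)
  rewrite {}/nu {}/w; case: h h0 hn => [|[|[|[|h]]]] // _ hn.
  - exists 1, 1; split=> //.
    have : 2 ^ 2 <= n ^ 2 by rewrite leq_sqr.
    lia.
  - exists 3, 2; have : 3 ^ 2 <= n ^ 2 by rewrite leq_sqr.
    by split=> //; lia.
  - exists 2, 1; have : 5 ^ 2 <= n ^ 2 by rewrite leq_sqr.
    split=> //; first exact: ltnW. lia.
  exists h.+3, 1; split=> //; first exact: ltnW.
  rewrite exp1n mul1n.
  move: hn; rewrite /= (expnS 2 h.+3); set x := 2 ^ h.+3 => hn.
  have : x ^ 2 <= n ^ 2 by rewrite leq_sqr ltnW.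
  have : 4 * (4 * h.+4 ^ 2 + 28 * h.+4) <= 100 * h.+3 ^ 2 by nia.
  by move=> h1 h2; have := leq_mul h1 h2; lia.
rewrite /host_order truncn_ge_nat ?powR_ge0 // natrX -(@powR_mulrn R 2 nu) // ler_powR ?ler1n //.
have l1 := log2_lower_bound R (leq_ltn_trans (leq0n _) hn) pq.
have q0R : (0 < q%:R :> R)%R by rewrite ltr0n.
rewrite -(@ler_pM2l _ (q%:R ^+ 2)%R) ?exprn_gt0 //.
apply: (@le_trans _ _ (100 * n%:R ^+ 2 * p%:R ^+ 2)%R).
  by rewrite -!natrX -!natrM ler_nat.
rewrite [leRHS](_ : _ = 100 * n%:R ^+ 2 * (q%:R * log2 n%:R) ^+ 2)%R; last by ring.
by apply: ler_pM; rewrite ?mulr_ge0 ?exprn_ge0 // lerXn2r // nnegrE ?(le_trans _ l1).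
Qed.

Lemma host_order1 (R : realType) : host_order R 1 = 1.
Proof. by rewrite /host_order /log2 ln1 mul0r expr0n /= mulr0 powRr0 truncn1. Qed.

(** * Copies in edge-ordered graphs *)

Section Restriction.
Variables (T : finType) (G : eograph T) (V : {set T}) (E : {set {set T}}).
Hypotheses (EG : E \subset edges G) (EV : forall e, e \in E -> e \subset V).

Let restrict_edgesP e : e \in E -> (e \subset V) && (#|e| == 2).
Proof. by move=> eE; rewrite EV //; have /andP[] := edgesP (subsetP EG e eE). Qed.

Let restrict_anti : {in E &, antisymmetric (edge_le G)}.
Proof. by move=> e e' /(subsetP EG) eG /(subsetP EG) e'G; exact: edge_le_anti. Qed.

Let restrict_trans : {in E & &, transitive (edge_le G)}.
Proof.
by move=> e1 e2 e3 /(subsetP EG) ? /(subsetP EG) ? /(subsetP EG) ?; exact: edge_le_trans.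
Qed.

Let restrict_total : {in E &, total (edge_le G)}.
Proof. by move=> e e' /(subsetP EG) eG /(subsetP EG) e'G; exact: edge_le_total. Qed.

Definition restriction : eograph T :=
  EOGraph restrict_edgesP restrict_anti restrict_trans restrict_total.

Lemma restriction_subgraph : V \subset verts G -> subgraph restriction G.
Proof. by move=> VG; split. Qed.

End Restriction.

(** The copy keeps only images of edges of [H], so [M] may have further edges between image
    vertices. *)
Lemma contains_copy_embedding (T U : finType) (M : eograph T) (H : eograph U) (psi : U -> T) :
  {in verts H &, injective psi} ->
  {in verts H, forall u, psi u \in verts M} ->
  {in edges H, forall e : {set U}, psi @: e \in edges M} ->
  {in edges H &, forall e e' : {set U}, edge_le M (psi @: e) (psi @: e') = edge_le H e e'} ->
  contains_copy M H.
Proof.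
move=> psi_inj psiV psiE psi_le.
have vertsE e : e \in edges H -> e \subset verts H by move/edgesP/andP=> [].
pose V := psi @: verts H; pose E := [set psi @: e | e : {set U} in edges H].
have EM : E \subset edges M by apply/subsetP => _ /imsetP[e eH ->]; exact: psiE.
have EV e : e \in E -> e \subset V by case/imsetP=> e' e'H ->; rewrite imsetS // vertsE.
exists (restriction EM EV); split.
  by apply: restriction_subgraph; apply/subsetP => _ /imsetP[u uH ->]; exact: psiV.
have ex (x : {x : T | x \in V}) : {u : {u : U | u \in verts H} | psi (val u) = val x}.
  apply: cid; have /imsetP[u uH xu] := valP x.
  by exists (exist _ u uH).
pose f x := projT1 (ex x).
have fK x : psi (val (f x)) = val x := projT2 (ex x).
have imset_sub (A B : {set U}) : A \subset verts H -> B \subset verts H ->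
    psi @: A \subset psi @: B -> A \subset B.
  move=> /subsetP AH /subsetP BH /subsetP AB; apply/subsetP => u uA.
  have /imsetP[v vB uv] := AB _ (imset_f psi uA).
  by rewrite (psi_inj _ _ (AH _ uA) (BH _ vB) uv).
have memE (A : {set U}) : A \subset verts H -> (psi @: A \in E) = (A \in edges H).
  move=> AH; apply/imsetP/idP => [[B BH AB]|AE]; last by exists A.
  suff -> : A = B by [].
  by apply/eqP; rewrite eqEsubset; apply/andP; split; apply: imset_sub; rewrite ?AB //; exact: vertsE.
have pairE x y : [set val x; val y] = psi @: [set val (f x); val (f y)].
  by rewrite imsetU1 imset_set1 !fK.
have pairV x y : [set val (f x); val (f y)] \subset verts H.
  by rewrite subUset !sub1set !(valP (f _)).
exists f; split.
- exists (fun u => exist _ (psi (val u)) (imset_f psi (valP u))) => [x|u]; apply: val_inj => /=.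
    exact: fK.
  by apply: psi_inj; rewrite ?(valP (f _)) ?(valP u) // fK.
- by move=> x y; rewrite pairE memE.
- move=> x1 y1 x2 y2; rewrite !pairE !memE // => e1 e2.
  by rewrite psi_le.
Qed.

Section EdgeRank.
Variables (U : finType) (H : eograph U).

Definition edge_rank e := #|[set e' in edges H | edge_le H e' e & e' != e]|.

Lemma edge_rank_lt e e' : e \in edges H -> e' \in edges H ->
  edge_le H e e' -> e != e' -> edge_rank e < edge_rank e'.
Proof.
move=> eH e'H ee' ne; apply/proper_card/properP; split.
  apply/subsetP => x; rewrite !inE => /and3P[xH xe nxe].
  rewrite xH (edge_le_trans eH xH e'H xe ee') /=; apply: contraNneq nxe => xe'.
  by apply/eqP/(edge_le_anti xH eH); rewrite xe xe' ee'.
by exists e; rewrite !inE ?eH ?ee' ?ne // eqxx !andbF.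
Qed.

Lemma edge_rank_bound e : edge_rank e <= 'C(#|verts H|, 2).
Proof.
rewrite -cards_draws; apply/subset_leq_card/subsetP => x.
by rewrite !inE => /and3P[/edgesP].
Qed.

(** Non-edges also get a value, meaningless but within [edge_rank_bound], so that every pair can be
    assigned a label slot. *)
Definition pair_rank u0 i j :=
  edge_rank [set nth u0 (enum (verts H)) i; nth u0 (enum (verts H)) j].

End EdgeRank.

(** * The labelled host as an edge-ordered graph, and its color classes *)

Section Host.
Variables (X : finType) (lab : X -> X -> nat) (k : nat).
Hypothesis labC : commutative lab.
(** The [k] extra elements are isolated vertices that pad the order. *)
Let T : finType := (X + 'I_k)%type.

Definition host_edge (x y : X) : {set T} := [set inl x; inl y].
(* Only the two orientations of e contribute, and they have the same label; the
   maximum merely avoids a choice. *)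
Definition edge_label (e : {set T}) := \max_(p : X * X | e == host_edge p.1 p.2) lab p.1 p.2.
Definition host_edges := [set e : {set T} | [exists p : X * X, (p.1 != p.2) && (e == host_edge p.1 p.2)]].
(** Ties within a label class are broken arbitrarily; the copies found have distinct labels on
    distinct edges. *)
Definition host_le (e e' : {set T}) :=
  (edge_label e < edge_label e') || (edge_label e == edge_label e') && (enum_rank e <= enum_rank e').

Lemma edge_labelE x y : edge_label (host_edge x y) = lab x y.
Proof.
apply/eqP; rewrite eqn_leq; apply/andP; split; last first.
  exact: (@leq_bigmax_cond _ (fun p : X * X => host_edge x y == host_edge p.1 p.2)
    (fun p => lab p.1 p.2) (x, y)).
apply/bigmax_leqP => -[x' y'] /= /eqP/setP E.
have := E (inl x); have := E (inl y); have := E (inl x'); have := E (inl y').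
rewrite !inE !(inj_eq inl_inj) !eqxx !orbT /= => /orP[]/eqP-> /orP[]/eqP-> //.
- by rewrite orbb => /esym/eqP ->.
- by rewrite labC.
- by rewrite !orbb => _ /esym/eqP ->.
Qed.

Let host_edgesP e : e \in host_edges -> (e \subset [set: T]) && (#|e| == 2).
Proof. by rewrite inE => /existsP[p /andP[p12 /eqP ->]]; rewrite subsetT cards2 (inj_eq inl_inj) p12. Qed.

Let host_le_anti : {in host_edges &, antisymmetric host_le}.
Proof.
move=> e e' _ _; rewrite /host_le => ee'; apply/enum_rank_inj/val_inj.
by move: ee'; rewrite /=; move: (nat_of_ord _) (nat_of_ord _); lia.
Qed.

Let host_le_trans : {in host_edges & &, transitive host_le}.
Proof. by move=> e e' e'' _ _ _; rewrite /host_le; move: (nat_of_ord _) (nat_of_ord _) (nat_of_ord _); lia. Qed.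

Let host_le_total : {in host_edges &, total host_le}.
Proof. by move=> e e' _ _; rewrite /host_le; move: (nat_of_ord _) (nat_of_ord _); lia. Qed.

Definition host : eograph T := EOGraph host_edgesP host_le_anti host_le_trans host_le_total.

Section Coloring.
Variables (c : {set T} -> bool) (b : bool).
Let E := [set e in host_edges | c e == b].
Let E_host : E \subset edges host.
Proof. by apply/subsetP => e; rewrite inE => /andP[]. Qed.

Definition color_class : eograph T := restriction E_host (fun e _ => subsetT e).

Lemma color_class_subgraph : subgraph color_class host.
Proof. exact: restriction_subgraph. Qed.

Lemma color_class_mono : monochromatic c color_class.
Proof. by exists b => e; rewrite inE => /andP[_ /eqP]. Qed.

(** Quotients by [m ^ r] increase strictly with the rank of the edge, hence so do the labels. *)
Lemma color_class_contains (U : finType) (H : eograph U) (u0 : U) (phi : nat -> X) (m r a : nat) :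
  (forall i j, i < j < #|verts H| -> [/\ phi i != phi j, c (host_edge (phi i) (phi j)) = b &
     lab (phi i) (phi j) %/ m ^ r = a * m + pair_rank H u0 i j]) ->
  contains_copy color_class H.
Proof.
move=> phiP; pose s := enum (verts H).
have memE u : (u \in s) = (u \in verts H) by rewrite mem_enum.
have sizeE : size s = #|verts H| by rewrite cardE.
pose psi u : T := inl (phi (index u s)).
have hostC x y : host_edge x y = host_edge y x by rewrite /host_edge setUC.
have pairP e : e \in edges H -> exists i j, [/\ i < j < #|verts H|,
    e = [set nth u0 s i; nth u0 s j] & psi @: e = host_edge (phi i) (phi j)].
  move=> eH; have /andP[/subsetP eV /cards2P[u [v [uv eE]]]] := edgesP eH.
  have us : u \in s by rewrite memE eV // eE !inE eqxx.
  have vs : v \in s by rewrite memE eV // eE !inE eqxx orbT.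
  have psiE : psi @: e = host_edge (phi (index u s)) (phi (index v s)).
    by rewrite eE imsetU1 imset_set1.
  have := us; have := vs; rewrite -!index_mem sizeE => iv iu.
  case: (ltngtP (index u s) (index v s)) => [lt|gt|eq].
  - by exists (index u s), (index v s); rewrite lt iv !nth_index.
  - by exists (index v s), (index u s); rewrite gt iu !nth_index // hostC setUC.
  - by case/eqP: uv; rewrite -(nth_index u0 us) eq nth_index.
have labelE e : e \in edges H -> edge_label (psi @: e) %/ m ^ r = a * m + edge_rank H e.
  move=> /pairP[i [j [ij eE ->]]]; have [_ _] := phiP i j ij.
  by rewrite edge_labelE /pair_rank -eE.
have label_lt e e' : e \in edges H -> e' \in edges H -> edge_le H e e' -> e != e' ->
    edge_label (psi @: e) < edge_label (psi @: e').
  move=> eH e'H ee' ne; have := edge_rank_lt eH e'H ee' ne.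
  rewrite -(ltn_add2l (a * m)) -!labelE //; apply: contraTT; rewrite -!leqNgt.
  exact: leq_div2r.
apply: (@contains_copy_embedding _ _ _ _ psi).
- move=> u v uH vH [] phi_eq; apply: contrapT => uv.
  have us : u \in s by rewrite memE.
  have vs : v \in s by rewrite memE.
  have := us; have := vs; rewrite -!index_mem sizeE => iv iu.
  case: (ltngtP (index u s) (index v s)) => [lt|gt|eq].
  + by have [] := phiP (index u s) (index v s); rewrite ?lt // phi_eq eqxx.
  + by have [] := phiP (index v s) (index u s); rewrite ?gt // phi_eq eqxx.
  + by apply: uv; rewrite -(nth_index u0 us) eq nth_index.
- by move=> u _; rewrite inE.
- move=> e /pairP[i [j [ij _ ->]]]; have [ne cb _] := phiP i j ij.
  by rewrite !inE cb eqxx andbT; apply/existsP; exists (phi i, phi j); rewrite ne /=.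
move=> e e' eH e'H /=; have [->|ne] := eqVneq e e'.
  rewrite /host_le eqxx leqnn orbT; apply/esym.
  by have := edge_le_total e'H e'H; rewrite orbb.
have [le|nle] := boolP (edge_le H e e'); first by rewrite /host_le label_lt.
have := edge_le_total eH e'H; rewrite (negbTE nle) /= => le'.
have := label_lt e' e e'H eH le'; rewrite eq_sym => /(_ ne).
rewrite /host_le; lia.
Qed.

End Coloring.
End Host.

Theorem theorem2 (R : realType) (n : nat) (n_gt0 : 0 < n) :
  exists (T : finType) (G : eograph T),
    #|verts G| = host_order R n /\
    forall c : {set T} -> bool,
      exists M : eograph T,
        [/\ subgraph M G,
            monochromatic c M
          & forall (U : finType) (H : eograph U),
              #|verts H| = n -> contains_copy M H].
Proof.
(* For n = 1 the height [h] would be 0; there the host is a single vertex. *)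
have [n1|n1] : n = 1 \/ 1 < n by lia.
  rewrite n1 host_order1.
  pose lab (x y : unit) := 0.
  have labC : commutative lab by [].
  exists (unit + 'I_0)%type, (host lab 0); split.
    by rewrite cardsT card_sum card_unit card_ord.
  move=> c; exists (color_class lab c true); split.
  - exact: color_class_subgraph.
  - exact: color_class_mono.
  move=> U H H1; have [u0 _] : exists u0, u0 \in verts H by apply/card_gt0P; rewrite H1.
  apply: (@color_class_contains _ lab _ labC c true _ H u0 (fun=> tt) 0 0 0) => i j.
  by rewrite H1; lia.
pose h := up_log 2 n; pose w := 2 ^ h.
have /andP[hn nw] : 2 ^ h.-1 < n <= w by exact: up_log_bounds.
have h0 : 0 < h by rewrite up_log_gt0.
have w0 : 0 < w by rewrite expn_gt0.
have lam0 : 0 < 2 * h * w by rewrite !muln_gt0 h0 w0.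
have [F _ cardF] := pPrimePowerField (isT : prime 2) lam0.
(* The dimension makes |X| = L^(2hw+14w), whose binary logarithm is 2hw(2hw+14w). *)
pose X := host_vertex F (2 * h * w + 14 * w).-1.
have cardX : #|{: X}| = 2 ^ (4 * h ^ 2 * w ^ 2 + 28 * h * w ^ 2).
  rewrite card_host_vertex cardF prednK ?addn_gt0 ?muln_gt0 ?w0 ?orbT // -expnM.
  by congr (2 ^ _); lia.
have few := host_order_lower_bound R h0 hn.
rewrite -/w -cardX in few.
pose lab := @host_label F (2 * h * w + 14 * w).-1.
have labC : commutative lab := @host_labelC _ _.
pose k := host_order R n - #|{: X}|.
exists (X + 'I_k)%type, (host lab k); split.
  by rewrite cardsT card_sum card_ord subnKC.
move=> c.
(* Either red contains every target, or one target [H1] missed by red forces every [H2] in blue. *)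
have [all_red|/existsNP[U1 /existsNP[H1 /not_implyP[H1n no_copy]]]] := pselect (forall (U : finType) (H : eograph U),
    #|verts H| = n -> contains_copy (color_class lab c true) H).
  exists (color_class lab c true); split=> //.
  - exact: color_class_subgraph.
  - exact: color_class_mono.
exists (color_class lab c false); split.
- exact: color_class_subgraph.
- exact: color_class_mono.
move=> U2 H2 H2n.
have rank_lt (U : finType) (H : eograph U) u0 i j : #|verts H| = n -> pair_rank H u0 i j < 2 ^ (2 * h).
  move=> Hn; apply: (leq_ltn_trans (edge_rank_bound _ _)).
  rewrite Hn bin2 -divn2 (leq_ltn_trans (leq_div _ _)) // (mulnC 2) expnM.
  by apply: (@leq_trans (n * n)); [rewrite ltn_pmul2l; lia | exact: leq_mul].
have [u1 _] : exists u1, u1 \in verts H1 by apply/card_gt0P; rewrite H1n.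
have [u2 _] : exists u2, u2 \in verts H2 by apply/card_gt0P; rewrite H2n.
have low := few_low (@host_first_moment F (2 * h * w + 14 * w).-1) (@host_pair_moment F _).
have high := few_high (@host_first_moment F (2 * h * w + 14 * w).-1) (@host_pair_moment F _).
rewrite cardF in low high.
(* All [w] positions are embedded; those from [n] on use the default of [nth] and are then
   ignored. *)
have [[] [phi [r [a phiP]]]] := two_color_ramsey (fun x y => c (host_edge k x y)) h0 cardX low high
    (fun i j _ => rank_lt U1 H1 u1 i j H1n) (fun i j _ => rank_lt U2 H2 u2 i j H2n).
  case: no_copy; apply: (@color_class_contains _ lab _ labC c true _ H1 u1 phi (2 ^ (2 * h)) r a) => i j.
  by rewrite H1n => /andP[ij jn]; apply: phiP; rewrite ij (leq_trans jn).
apply: (@color_class_contains _ lab _ labC c false _ H2 u2 phi (2 ^ (2 * h)) r a) => i j.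
by rewrite H2n => /andP[ij jn]; apply: phiP; rewrite ij (leq_trans jn).
Qed.
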